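(* Let $\ell,n,m\in\mathbb{N}^*=\{1,2,\dots\}$. The set $$S=\left\{(E,A,B)\in\Sigma_{\ell,n,m}\;\middle|\;\text{the system } \tfrac{\mathrm{d}}{\mathrm{d}t}(Ex)=Ax+Bu \text{ is completely stabilizable}\right\}$$ is generic if, and only if, $\ell<n+m$.
   Context: $\Sigma_{\ell,n,m}:=\mathbb{R}^{\ell\times n}\times\mathbb{R}^{\ell\times n}\times\mathbb{R}^{\ell\times m}$, identified with $\mathbb{R}^{2\ell n+\ell m}$ by listing matrix entries. A set $\mathbb{V}\subseteq\mathbb{R}^N$ is an algebraic variety if it is the set of common zeros of finitely many polynomials in $\mathbb{R}[x_1,\dots,x_N]$; it is proper if $\mathbb{V}\neq\mathbb{R}^N$. A set $S\subseteq\mathbb{R}^N$ is generic if its complement is contained in some proper algebraic variety. A mapping $(x,u):\mathbb{R}\to\mathbb{R}^n\times\mathbb{R}^m$ is a solution of $\tfrac{\mathrm{d}}{\mathrm{d}t}(Ex)=Ax+Bu$ if $x\in\mathcal{L}^1_{\mathrm{loc}}(\mathbb{R},\mathbb{R}^n)$, $u\in\mathcal{L}^1_{\mathrm{loc}}(\mathbb{R},\mathbb{R}^m)$ (locally integrable functions), $Ex:\mathbb{R}\to\mathbb{R}^\ell$ is (locally) absolutely continuous, and $\tfrac{\mathrm{d}}{\mathrm{d}t}(Ex)(t)=Ax(t)+Bu(t)$ for all $t$ outside a Lebesgue nullset. The set of all solutions is denoted $\mathfrak{B}_{[E,A,B]}$. The system $(E,A,B)$ is completely stabilizable if for every $x_0\in\mathbb{R}^n$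 there exists $(x,u)\in\mathfrak{B}_{[E,A,B]}$ with $x(0)=x_0$ and $\lim_{t\to\infty}\operatorname{ess\,sup}_{s\in(t,\infty)}\|x(s)\|=0$, where the essential supremum is the infimum, over all Lebesgue nullsets $N$, of the supremum over $(t,\infty)\setminus N$. *)

(* Defs.v *)
From mathcomp Require Import all_boot all_order all_algebra.
From mathcomp Require Import all_classical all_reals all_analysis.
(* The notations of [mpoly] clash with those of the analysis library. *)
From mathcomp Require Import -(notations) mpoly.

Set Implicit Arguments.
Unset Strict Implicit.
Unset Printing Implicit Defensive.

Import Order.TTheory GRing.Theory Num.Theory.
Import numFieldNormedType.Exports.

Local Open Scope classical_set_scope.
Local Open Scope ring_scope.

Definition algebraic_variety (R : realType) (N : nat)
    (V : set 'rV[R]_N) : Prop :=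
  exists ps : seq (mpoly N R),
    V = [set v | forall p, p \in ps -> meval (v ord0) p = 0].

Definition generic (R : realType) (N : nat) (S : set 'rV[R]_N) : Prop :=
  exists V : set 'rV[R]_N,
    [/\ algebraic_variety V, V <> [set: 'rV[R]_N] & ~` S `<=` V].

Definition system (R : realType) (l n m : nat) : Type :=
  ('M[R]_(l, n) * 'M[R]_(l, n) * 'M[R]_(l, m))%type.

(* The identification of the system space with R^(2ln + lm). *)
Definition entries (R : realType) (l n m : nat) (s : system R l n m) :
    'rV[R]_(l * n + l * n + l * m) :=
  row_mx (row_mx (mxvec s.1.1) (mxvec s.1.2)) (mxvec s.2).

(* Integrability refers to the completed measure, so that f only has to be
   Lebesgue measurable; [locally_integrable] of the library asks for Borel
   measurability. *)
Definition L1loc (R : realType) (k : nat) (f : R -> 'cV[R]_k) : Prop :=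
  forall (i : 'I_k) (K : set R), compact K ->
    (@completed_lebesgue_measure R).-integrable K (fun t => (f t i ord0)%:E).

Definition locally_absolutely_continuous (R : realType) (k : nat)
    (f : R -> 'cV[R]_k) : Prop :=
  forall a b : R, forall e : R, 0 < e -> exists2 d : R, 0 < d &
    forall (r : nat) (p q : 'I_r -> R),
      (forall i, [/\ a <= p i, p i <= q i & q i <= b]) ->
      trivIset [set: 'I_r] (fun i => `]p i, q i[%classic) ->
      \sum_(i < r) (q i - p i) < d ->
      \sum_(i < r) `|f (q i) - f (p i)| < e.

Definition behavior (R : realType) (l n m : nat) (s : system R l n m) :
    set ((R -> 'cV[R]_n) * (R -> 'cV[R]_m)) :=
  let: (E, A, B) := s in
  [set xu | let: (x, u) := xu in
    [/\ L1loc x, L1loc u,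
        locally_absolutely_continuous (fun t => E *m x t) &
        {ae @lebesgue_measure R, forall t : R,
          is_derive t (1 : R) (fun r => E *m x r) (A *m x t + B *m u t)}]].

(* Negligible sets are the subsets of Borel sets of measure zero, i.e. the
   Lebesgue nullsets. *)
Definition ess_sup_on (R : realType) (D : set R) (f : R -> R) : \bar R :=
  ereal_inf [set ereal_sup [set (f r)%:E | r in D `\` N] |
              N in (@lebesgue_measure R).-negligible].

(* The norm on 'cV[R]_n is the maximum norm. *)
Definition completely_stabilizable (R : realType) (l n m : nat)
    (s : system R l n m) : Prop :=
  forall x0 : 'cV[R]_n, exists x : R -> 'cV[R]_n, exists u : R -> 'cV[R]_m,
    [/\ behavior s (x, u), x 0 = x0 &
        ess_sup_on `]t, +oo[%classic (fun r => `|x r|) @[t --> +oo] --> 0%E].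

(* Main.v *)
(** Call a mode a pair (x, u) with (lambda E - A) x = B u; then
    (x, u) exp(lambda t) is a solution.  If l < n + m, take the n rates
    -1, ..., -n, with D their diagonal matrix.  Surjectivity of the linear map
      (X, U) |-> (E X D - A X - B U, sum of the columns of X)
    provides, for every x0, modes whose sum starts at x0, hence a smooth solution
    decaying to 0; and surjectivity is the nonvanishing of some maximal minor, a
    polynomial in the entries of (E, A, B).  It holds for A = E D with E the
    partial identity and a suitable B: there X = 1, U = 0 are modes.

    If n + m <= l, start from E = A = [1; 0; 0], B = [0; 1; 0].  For every nearby
    system some P satisfies P E = c 1, P B = 0 with c > 0 and P A close to 1, so
    along any solution |x|^2 is absolutely continuous with nonnegative derivative
    almost everywhere, hence nondecreasing: the system is not stabilizable.  A
    polynomial that vanishes on all nonstabilizable systems thus vanishes near that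
    point on every line through it, hence identically. *)

Require Import Defs.
From mathcomp Require Import all_boot all_order all_algebra.
From mathcomp Require Import all_classical all_reals all_analysis.
From mathcomp Require Import measurable_realfun.
From mathcomp Require Import -(notations) mpoly.
From mathcomp Require Import zify lra.

Set Implicit Arguments.
Unset Strict Implicit.
Unset Printing Implicit Defensive.

Import Order.TTheory GRing.Theory Num.Theory.
Import numFieldNormedType.Exports.

Local Open Scope classical_set_scope.
Local Open Scope ring_scope.

(** * Polynomial functions and generic sets *)

(** Working with functions rather than [mpoly] terms lets closure rules show that determinants and
    adjugates of matrices are polynomial in the entries. *)
Definition polynomial_fun (R : realType) (N : nat) (f : 'rV[R]_N -> R) : Prop :=
  exists p : mpoly N R, forall v : 'rV[R]_N, meval (v ord0) p = f v.

Section PolynomialFun.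
Variables (R : realType) (N : nat).
Implicit Types f g : 'rV[R]_N -> R.

Lemma polynomial_fun_ext f g : f =1 g -> polynomial_fun f -> polynomial_fun g.
Proof. by move=> fg [p pf]; exists p => v; rewrite pf. Qed.

Lemma polynomial_fun_cst c : polynomial_fun (fun _ : 'rV[R]_N => c).
Proof. by exists (mpolyC N c) => v; rewrite mevalC. Qed.

Lemma polynomial_fun_coord i : polynomial_fun (fun v : 'rV[R]_N => v ord0 i).
Proof. by exists (mpolyX R (mnm1 i)) => v; rewrite mevalXU. Qed.

Lemma polynomial_funN f : polynomial_fun f -> polynomial_fun (fun v => - f v).
Proof. by move=> [p pf]; exists (- p) => v; rewrite mevalN pf. Qed.

Lemma polynomial_funD f g : polynomial_fun f -> polynomial_fun g ->
  polynomial_fun (fun v => f v + g v).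
Proof. by move=> [p pf] [q qg]; exists (p + q) => v; rewrite mevalD pf qg. Qed.

Lemma polynomial_funB f g : polynomial_fun f -> polynomial_fun g ->
  polynomial_fun (fun v => f v - g v).
Proof. by move=> pf /polynomial_funN; apply: polynomial_funD. Qed.

Lemma polynomial_funM f g : polynomial_fun f -> polynomial_fun g ->
  polynomial_fun (fun v => f v * g v).
Proof. by move=> [p pf] [q qg]; exists (p * q) => v; rewrite mevalM pf qg. Qed.

Lemma polynomial_fun_sum (I : Type) (r : seq I) (P : pred I)
    (F : I -> 'rV[R]_N -> R) : (forall i, polynomial_fun (F i)) ->
  polynomial_fun (fun v => \sum_(i <- r | P i) F i v).
Proof.
move=> pF; elim: r => [|i r IHr].
  apply: polynomial_fun_ext (polynomial_fun_cst 0) => v.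
  by rewrite big_nil.
have [Pi|nPi] := boolP (P i); last first.
  by apply: polynomial_fun_ext IHr => v; rewrite big_cons (negbTE nPi).
apply: polynomial_fun_ext (polynomial_funD (pF i) IHr) => v.
by rewrite big_cons Pi.
Qed.

Lemma polynomial_fun_prod (I : Type) (r : seq I) (P : pred I)
    (F : I -> 'rV[R]_N -> R) : (forall i, polynomial_fun (F i)) ->
  polynomial_fun (fun v => \prod_(i <- r | P i) F i v).
Proof.
move=> pF; elim: r => [|i r IHr].
  apply: polynomial_fun_ext (polynomial_fun_cst 1) => v.
  by rewrite big_nil.
have [Pi|nPi] := boolP (P i); last first.
  by apply: polynomial_fun_ext IHr => v; rewrite big_cons (negbTE nPi).
apply: polynomial_fun_ext (polynomial_funM (pF i) IHr) => v.
by rewrite big_cons Pi.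
Qed.

Definition polynomial_mx (a b : nat) (M : 'rV[R]_N -> 'M[R]_(a, b)) : Prop :=
  forall i j, polynomial_fun (fun v => M v i j).

Lemma polynomial_mx_cst a b (M : 'M[R]_(a, b)) : polynomial_mx (fun _ : 'rV[R]_N => M).
Proof. by move=> i j; apply: polynomial_fun_cst. Qed.

Lemma polynomial_mxB a b (M M' : 'rV[R]_N -> 'M[R]_(a, b)) :
  polynomial_mx M -> polynomial_mx M' -> polynomial_mx (fun v => M v - M' v).
Proof.
move=> pM pM' i j; apply: polynomial_fun_ext (polynomial_funB (pM i j) (pM' i j)).
by move=> v; rewrite !mxE.
Qed.

Lemma polynomial_mxM a b c (M : 'rV[R]_N -> 'M[R]_(a, b))
    (M' : 'rV[R]_N -> 'M[R]_(b, c)) :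
  polynomial_mx M -> polynomial_mx M' -> polynomial_mx (fun v => M v *m M' v).
Proof.
move=> pM pM' i j.
apply: (polynomial_fun_ext (f := fun v => \sum_k M v i k * M' v k j)).
  by move=> v; rewrite mxE.
by apply: polynomial_fun_sum => k; apply: polynomial_funM.
Qed.

Lemma polynomial_mx_row a b c (M : 'rV[R]_N -> 'M[R]_(a, b))
    (M' : 'rV[R]_N -> 'M[R]_(a, c)) :
  polynomial_mx M -> polynomial_mx M' ->
  polynomial_mx (fun v => row_mx (M v) (M' v)).
Proof.
move=> pM pM' i j; have [k ->|k ->] := split_ordP j.
  by apply: polynomial_fun_ext (pM i k) => v; rewrite row_mxEl.
by apply: polynomial_fun_ext (pM' i k) => v; rewrite row_mxEr.
Qed.

Lemma polynomial_fun_det a (M : 'rV[R]_N -> 'M[R]_a) :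
  polynomial_mx M -> polynomial_fun (fun v => \det (M v)).
Proof.
move=> pM; apply: polynomial_fun_sum => s; apply: polynomial_funM.
  exact: polynomial_fun_cst.
by apply: polynomial_fun_prod => i.
Qed.

Lemma polynomial_mx_adj a (M : 'rV[R]_N -> 'M[R]_a) :
  polynomial_mx M -> polynomial_mx (fun v => \adj (M v)).
Proof.
move=> pM i j.
apply: (polynomial_fun_ext (f := fun v => cofactor (M v) j i)).
  by move=> v; rewrite mxE.
apply: polynomial_funM; first exact: polynomial_fun_cst.
apply: polynomial_fun_det => i' j'.
by apply: polynomial_fun_ext (pM _ _) => v; rewrite !mxE.
Qed.

(** Restriction to a line gives a univariate polynomial, for which root counting is available. Each
    coordinate is affine in [t], so induction on monomials applies. *)
Lemma polynomial_fun_line f (v w : 'rV[R]_N) : polynomial_fun f ->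
  exists q : {poly R}, forall t, q.[t] = f (v + t *: w).
Proof.
case=> p pf.
suff [q qE] : exists q : {poly R},
    forall t, q.[t] = meval ((v + t *: w) ord0) p.
  by exists q => t; rewrite qE pf.
elim/mpolyind: p {pf} => [|c m p _ _ [q qE]].
  by exists 0 => t; rewrite horner0 meval0.
exists (c *: (\prod_i ((v ord0 i)%:P + w ord0 i *: 'X) ^+ m i) + q) => t.
rewrite hornerD hornerZ mevalD mevalZ qE mevalX horner_prod.
congr (_ * _ + _); apply: eq_bigr => i _.
by rewrite !hornerE !mxE mulrC.
Qed.

Lemma generic_polynomial (S : set 'rV[R]_N) f v0 : polynomial_fun f ->
  f v0 != 0 -> (forall v, f v != 0 -> S v) -> generic S.
Proof.
case=> p pf fv0 fS; exists [set v : 'rV[R]_N | meval (v ord0) p = 0]; split.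
- exists [:: p]; apply/seteqP; split=> v /=.
    by move=> pv q; rewrite inE => /eqP ->.
  by apply; rewrite inE.
- by move=> /seteqP[_ /(_ v0 I)] /=; rewrite pf; apply/eqP.
- move=> v nSv /=; rewrite pf; apply: contrapT => /eqP fv.
  exact/nSv/fS.
Qed.

(** At a point off the variety one of the defining polynomials is nonzero, and that single
    polynomial suffices. *)
Lemma generic_polynomialP (S : set 'rV[R]_N) : generic S ->
  exists f v0, [/\ polynomial_fun f, f v0 != 0 & forall v, ~ S v -> f v = 0].
Proof.
move=> [V [[ps ->] Vproper SV]].
have [v0 nv0] : exists v0 : 'rV[R]_N,
    ~ forall p, p \in ps -> meval (v0 ord0) p = 0.
  apply: contrapT => nex; apply: Vproper; apply/seteqP; split=> // v _ /=.
  by apply: contrapT => nv; apply: nex; exists v.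
have [p [pps pv0]] : exists p, p \in ps /\ meval (v0 ord0) p <> 0.
  apply: contrapT => nex; apply: nv0 => p pps.
  by apply: contrapT => nv; apply: nex; exists p.
exists (fun v : 'rV[R]_N => meval (v ord0) p), v0; split; first by exists p.
  exact/eqP.
by move=> v /SV /= /(_ p pps).
Qed.

(** The rows that form an invertible square submatrix at [v0] are kept fixed. Their determinant is
    polynomial in [v], and where it is nonzero these rows already span. *)
Lemma generic_row_full a b (T : 'rV[R]_N -> 'M[R]_(a, b)) v0 :
  polynomial_mx T -> row_full (T v0) -> generic [set v | row_full (T v)].
Proof.
move=> pT fT.
pose s := fullrankfun fT.
have pd : polynomial_fun (fun v => \det (rowsub s (T v))).
  apply: polynomial_fun_det => i j.
  by apply: polynomial_fun_ext (pT (s i) j) => v; rewrite mxE.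
apply: (generic_polynomial pd (v0 := v0)).
  by rewrite -unitfE -unitmxE -row_full_unit fullrowsub_full.
move=> v /= dv; rewrite -sub1mx.
have : row_full (rowsub s (T v)) by rewrite row_full_unit unitmxE unitfE.
by rewrite -sub1mx => /submx_trans; apply; apply: rowsub_sub.
Qed.

End PolynomialFun.

(** * Absolutely continuous functions *)

Definition abs_cont_on (R : realType) (a b : R) (g : R -> R) : Prop :=
  forall e : R, 0 < e -> exists2 d : R, 0 < d &
    forall (r : nat) (p q : 'I_r -> R),
      (forall i, [/\ a <= p i, p i <= q i & q i <= b]) ->
      trivIset [set: 'I_r] (fun i => `]p i, q i[%classic) ->
      \sum_(i < r) (q i - p i) < d ->
      \sum_(i < r) `|g (q i) - g (p i)| < e.

(** The slack [e] absorbs the error of the difference quotient. Both sides of [t] are needed, since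
    real induction steps into [t] as well as out of it. *)
Lemma derivable_locally_nondecreasing (R : realType) (g : R -> R) (t d e : R) :
  is_derive t 1 g d -> 0 <= d -> 0 < e ->
  exists2 rho : R, 0 < rho & forall h, 0 <= h -> h < rho ->
    g t - e * h <= g (t + h) /\ g (t - h) - e * h <= g t.
Proof.
move=> [gd gdE] d_ge0 e_gt0.
have /cvgrPdist_le /(_ _ e_gt0) : (fun h => h^-1 *: ((g \o shift t) (h *: 1) - g t))
    @ 0^' --> d by rewrite -gdE; exact: gd.
move=> /nbhs_ballP[rho /= rho_gt0 grho].
have slope k : k != 0 -> `|k| < rho -> `|d * k - (g (t + k) - g t)| <= e * `|k|.
  move=> k_neq0 k_rho; have := grho k.
  rewrite -ball_normE /= sub0r normrN => /(_ k_rho k_neq0).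
  rewrite scaler1 -(ler_pM2r (x := `|k|)) ?normr_gt0// -normrM.
  by rewrite mulrBl /GRing.scale/= mulrAC mulVf// mul1r [k + t]addrC.
exists rho => // h; rewrite le_eqVlt => /predU1P[<- _|h_gt0 h_rho].
  by rewrite addr0 subr0 mulr0 subr0.
have dh_ge0 : 0 <= d * h by rewrite mulr_ge0// ltW.
have := slope h; have := slope (- h).
rewrite normrN oppr_eq0 gt_eqF// gtr0_norm// => /(_ isT h_rho) + /(_ isT h_rho).
rewrite !ler_norml => /andP[H1 _] /andP[_ H2]; split; lra.
Qed.

Section AbsContMonotone.
Variable R : realType.
Local Notation mu := (@lebesgue_measure R).
Implicit Types (a b t : R) (g : R -> R) (U N : set R).

(** The total length is the measure of the disjoint union, which lies in [U]. *)
Lemma disjoint_itv_length_le (r : nat) (p q : 'I_r -> R) U (d : R) :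
  open U -> (mu U < d%:E)%E ->
  (forall i, p i <= q i) -> (forall i, `]p i, q i[%classic `<=` U) ->
  trivIset [set: 'I_r] (fun i => `]p i, q i[%classic) ->
  \sum_(i < r) (q i - p i) < d.
Proof.
move=> oU Ud pq pqU tpq; rewrite -lte_fin; apply: le_lt_trans Ud.
have -> : (\sum_(i < r) (q i - p i))%:E =
    mu (\big[setU/set0]_(i < r) `]p i, q i[%classic).
  rewrite measure_bigsetU_ord// -sumEFin; apply: eq_bigr => i _.
  have := lebesgue_measure_itv `]p i, q i[; rewrite /= lte_fin => ->.
  case: ltP => //; rewrite le_eqVlt ltNge pq orbF => /eqP ->.
  by rewrite subrr.
apply: le_measure; rewrite ?inE.
- by apply: bigsetU_measurable => i _; exact: measurable_itv.
- exact: open_measurable.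
- by elim/big_ind: _ => [|X Y XU YU|i _]; rewrite ?subUset.
Qed.

(* Real induction along [a, b]: the loss of g is at most e per unit length,
   except on finitely many intervals inside the small open set U covering N,
   where absolute continuity bounds it. *)
Lemma abs_cont_nondecreasing g a b N : a <= b -> abs_cont_on a b g ->
  mu.-negligible N ->
  (forall t, ~ N t -> exists2 d, is_derive t 1 g d & 0 <= d) ->
  g a <= g b.
Proof.
move=> ab gac [N' [mN' N'0 NN']] gder.
have [//|gba] := leP (g a) (g b).
(* With this [e] the admissible total loss [e * (b - a) + e] is less than [g a - g b], which will
   contradict [g b < g a]. *)
pose e := (g a - g b) / (b - a + 2).
have e_gt0 : 0 < e by rewrite divr_gt0//; lra.
have eE : e * (b - a + 2) = g a - g b by rewrite mulfVK//; apply/eqP; lra.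
have [d d_gt0 gd] := gac _ e_gt0.
have N'fin : (mu N' < +oo)%E by rewrite [mu N']N'0.
have [U [oU N'U UN'd]] := lebesgue_regularity_outer mN' N'fin d_gt0.
have Ud : (mu U < d%:E)%E.
  apply: le_lt_trans UN'd; rewrite -[X in (_ <= X)%E]adde0 -[X in (_ + X)%E]N'0.
  rewrite -{1}(setDUK N'U) setUC measureU2//.
  by apply: measurableD => //; exact: open_measurable.
(* [Q t]: up to [t], any loss beyond [e] per unit length is charged to finitely many disjoint
   intervals inside [U]. *)
pose Q t := a <= t <= b /\ exists r (p q : 'I_r -> R),
  [/\ forall i, [/\ a <= p i, p i <= q i & q i <= t],
      trivIset [set: 'I_r] (fun i => `]p i, q i[%classic),
      forall i, `]p i, q i[%classic `<=` U &
      g a - e * (t - a) - \sum_(i < r) `|g (q i) - g (p i)| <= g t].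
have Qext s t : s <= t -> t <= b ->
    `]s, t[%classic `<=` U \/ g s - e * (t - s) <= g t -> Q s -> Q t.
  move=> st tb stU [/andP[a_s sb] [r [p [q [pq tpq pqU gs]]]]].
  split; first by rewrite tb (le_trans a_s).
  case: stU => [stU|gst]; last first.
    exists r, p, q; split => //; last by lra.
    by move=> i; have [? ? qs] := pq i; split=> //; apply: le_trans st.
  (* The new interval gets index [ord0]; the old ones end at or before [s], so disjointness
     persists. *)
  exists r.+1, (fun i => oapp p s (unlift ord0 i)), (fun i => oapp q t (unlift ord0 i)).
  split.
  - move=> i; case: unliftP => [j _|_] /=; last by split.
    by have [? ? qs] := pq j; split=> //; apply: le_trans st.
  - move=> i j _ _ [x [/=]].
    case: unliftP => [i' ->|->] /=; case: unliftP => [j' ->|->] //=.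
    + by move=> xi xj; congr lift; apply: tpq => //; exists x.
    + rewrite !in_itv /= => /andP[_ xi] /andP[sx _].
      by have [_ _ qs] := pq i'; move: (lt_trans sx xi); rewrite ltNge qs.
    + rewrite !in_itv /= => /andP[sx _] /andP[_ xj].
      by have [_ _ qs] := pq j'; move: (lt_trans sx xj); rewrite ltNge qs.
  - by move=> i; case: unliftP => [j _|_] //=; exact: pqU.
  - rewrite big_ord_recl unlift_none /=.
    under eq_bigr do rewrite liftK /=.
    have := ler_norm (g s - g t); rewrite distrC.
    have : 0 <= e * (t - s) by rewrite mulr_ge0 ?subr_ge0 ?(ltW e_gt0).
    lra.
(* Near a point of the open set [U] an interval inside [U] can be added; any other point is outside
   [N], and there the derivative bounds the loss. *)
have Qlocal t : exists2 rho : R, 0 < rho & forall s,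
    (s <= t -> t - s < rho -> t <= b -> Q s -> Q t) /\
    (t <= s -> s - t < rho -> s <= b -> Q t -> Q s).
  have [Ut|nUt] := pselect (U t).
    have /nbhs_ballP[rho /= rho_gt0 tU] : nbhs t U by apply: open_nbhs_nbhs.
    exists rho => // s; split=> st ts tb; apply: Qext => //; left => x /=.
      rewrite in_itv /= => /andP[sx xt]; apply: tU.
      by rewrite -ball_normE /= gtr0_norm; lra.
    rewrite in_itv /= => /andP[sx xt]; apply: tU.
    by rewrite -ball_normE /= ltr0_norm; lra.
  have [//|dt gt dt_ge0] := gder t; first by move=> /NN' /N'U.
  have [rho rho_gt0 grho] := derivable_locally_nondecreasing gt dt_ge0 e_gt0.
  exists rho => // s; split=> st ts tb; apply: Qext => //; right.
    by have [|//|_] := grho (t - s); [lra|]; rewrite subKr.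
  by have [|//|+ _] := grho (s - t); [lra|]; rewrite [t + _]addrC subrK.
have Qa : Q a.
  split; first by rewrite lexx.
  exists 0%N, (fun=> a), (fun=> a); split=> [[]//|[]//|[]//|].
  by rewrite big_ord0; lra.
have Qhas : has_sup Q.
  by split; [exists a|exists b => t [/andP[]]].
set T := sup Q.
have aT : a <= T by apply: sup_upper_bound.
have Tb : T <= b by apply: ge_sup; [exists a|move=> t [/andP[]]].
(* A step from the left shows that the supremum [T] satisfies [Q]; were [T < b], a step to the right
   would pass it. *)
have [rho rho_gt0 Trho] := Qlocal T.
have QT : Q T.
  have [s Qs Ts] := sup_adherent rho_gt0 Qhas.
  have sT : s <= T by apply: sup_upper_bound.
  by apply: (Trho s).1 => //; rewrite -/T in Ts; lra.
have Qb : Q b.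
  have [bT|Tltb] := leP b T; first by rewrite (_ : b = T)//; lra.
  pose s := Num.min b (T + rho / 2).
  have Ts : T < s by rewrite lt_min Tltb /= ltrDl divr_gt0.
  have sb : s <= b by rewrite ge_min lexx.
  have : s <= T + rho / 2 by rewrite ge_min lexx orbT.
  move=> sT; have : s <= T by apply: sup_upper_bound => //; apply: (Trho s).2 QT; lra.
  lra.
have [_ [r [p [q [pq tpq pqU gb]]]]] := Qb.
have := gd r p q pq tpq.
rewrite (disjoint_itv_length_le oU Ud _ pqU tpq) => [|i]; last by have [] := pq i.
move=> /(_ isT); lra.
Qed.

End AbsContMonotone.

(** * Solutions that are sums of exponentials *)

Section EssSup.
Variable R : realType.
Implicit Types (t c : R) (f : R -> R).

(** A half-line has infinite measure, so no nullset covers it and some value of [f] always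
    remains. *)
Lemma ess_sup_on_ge t c f : (forall r, t < r -> c <= f r) ->
  (c%:E <= ess_sup_on `]t, +oo[%classic f)%E.
Proof.
move=> cf; apply: le_ereal_inf_tmp => _ [N [N' [mN' N'0 NN']] <-].
have [r [tr nNr]] : exists r, t < r /\ ~ N r.
  apply: contrapT => nex.
  have : (@lebesgue_measure R `]t, +oo[%classic <= @lebesgue_measure R N')%E.
    apply: le_measure; rewrite ?inE => //.
    move=> r /=; rewrite in_itv /= andbT => tr; apply: NN'.
    by apply: contrapT => nNr; apply: (nex); exists r.
  rewrite [X in (_ <= X)%E]N'0.
  by have -> := lebesgue_measure_itv `]t, +oo[; rewrite /= ltry.
apply: le_ereal_sup_tmp; exists (f r)%:E; last by rewrite lee_fin cf.
by exists r => //; split=> //=; rewrite in_itv /= tr.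
Qed.

Lemma ess_sup_on_le t c f : (forall r, t < r -> f r <= c) ->
  (ess_sup_on `]t, +oo[%classic f <= c%:E)%E.
Proof.
move=> fc; apply: ge_ereal_inf.
exists (ereal_sup [set (f r)%:E | r in `]t, +oo[%classic `\` set0]).
  by exists set0 => //; exact: negligible_set0.
apply: ge_ereal_sup => _ [r [/= tr _] <-]; rewrite lee_fin fc//.
by move: tr; rewrite in_itv /= andbT.
Qed.

End EssSup.

(** * Integrability and absolute continuity of smooth functions *)

Section SmoothFunctions.
Variable R : realType.

(** Borel sets are measurable for the completed measure, and a continuous function is bounded on a
    compact set, which has finite measure. *)
Lemma L1loc_continuous k (f : R -> 'cV[R]_k) :
  (forall i, continuous (fun t => f t i ord0)) -> L1loc f.
Proof.
move=> fc i K cK.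
have mK := compact_measurable cK.
apply: measurable_bounded_integrable.
- exact: sub_caratheodory.
- exact: compact_finite_measure.
- move=> _ Y mY; apply: sub_caratheodory.
  suff : measurable_fun (K : set (measurableTypeR R)) (fun t => f t i ord0) by apply.
  by apply: subspace_continuous_measurable_fun => //; exact: continuous_subspaceT.
- have := continuous_compact (continuous_subspaceT (fc i)) cK.
  move=> /compact_bounded[M [_ mrt]].
  by exists M; split; rewrite ?num_real // => y My t Kt; apply: (mrt y My); exists t.
Qed.

Lemma is_derive_mx a b (F : R -> 'M[R]_(a, b)) (t : R) (F' : 'M[R]_(a, b)) :
  (forall i j, is_derive t 1 (fun r => F r i j) (F' i j)) -> is_derive t 1 F F'.
Proof.
move=> dF; have Fd : derivable F t 1 by apply/derivable_mxP => i j; have [] := dF i j.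
split=> //; rewrite derive_mx//; apply/matrixP => i j; rewrite mxE.
exact: derive_val.
Qed.

Lemma is_derive_mxE a b (F : R -> 'M[R]_(a, b)) (t : R) (F' : 'M[R]_(a, b)) i j :
  is_derive t 1 F F' -> is_derive t 1 (fun r => F r i j) (F' i j).
Proof.
move=> [Fd <-]; rewrite derive_mx// mxE; apply/derivableP.
by move/derivable_mxP : Fd.
Qed.

(** The derivative is bounded on [[a, b]], so the mean value theorem in each coordinate makes [f]
    Lipschitz there. *)
Lemma locally_absolutely_continuous_C1 k (f f' : R -> 'cV[R]_k) :
  (forall t : R, is_derive t (1 : R) f (f' t)) ->
  (forall i, continuous (fun t => f' t i ord0)) ->
  locally_absolutely_continuous f.
Proof.
move=> df f'c a b e e_gt0.
have [L L_ge0 fL] : exists2 L : R, 0 <= L & forall p q, a <= p -> p <= q -> q <= b ->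
    `|f q - f p| <= L * (q - p).
  have bnd i : exists2 L : R, 0 <= L & forall t, a <= t <= b -> `|f' t i ord0| <= L.
    have := continuous_compact (continuous_subspaceT (f'c i)) (@segment_compact R a b).
    move=> /compact_bounded[M [_ mrt]].
    exists (`|M| + 1) => [|t tab]; first by rewrite addr_ge0.
    apply: (mrt (`|M| + 1)); first by rewrite (le_lt_trans (ler_norm M))// ltrDl.
    by exists t => //=; rewrite in_itv.
  have /choice[L LP] : forall i, exists L : R, 0 <= L /\
      forall t, a <= t <= b -> `|f' t i ord0| <= L.
    by move=> i; have [L ? ?] := bnd i; exists L.
  exists (\sum_i L i) => [|p q ap pq qb].
    by apply: sumr_ge0 => i _; exact: (LP i).1.
  rewrite [leLHS]/Num.Def.normr/= mx_normrE; apply: bigmax_le => /= [|[i j] _ /=].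
    by rewrite mulr_ge0 ?subr_ge0// sumr_ge0// => i _; exact: (LP i).1.
  rewrite ord1 !mxE.
  have [t||t pqt ->] := MVT_segment (f := fun t => f t i ord0)
      (df := fun t => f' t i ord0) pq.
  - by move=> _; exact: is_derive_mxE.
  - apply: derivable_within_continuous => t _.
    by have [] := is_derive_mxE i ord0 (df t).
  move: pqt; rewrite in_itv /= => /andP[pt tq].
  rewrite normrM [`|q - p|]ger0_norm ?subr_ge0// ler_wpM2r ?subr_ge0//.
  apply: le_trans ((LP i).2 t _) _; first by rewrite (le_trans ap)//= (le_trans tq).
  rewrite (bigD1 i)//= lerDl; apply: sumr_ge0 => j' _; exact: (LP j').1.
(* The Lipschitz constant [L] may be 0, hence [L + 1]. *)
exists (e / (L + 1)) => [|r p q pq _ pqd]; first by rewrite divr_gt0// ltr_wpDl.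
apply: (@le_lt_trans _ _ (L * \sum_(i < r) (q i - p i))).
  rewrite mulr_sumr; apply: ler_sum => i _; have [? ? ?] := pq i; exact: fL.
have S_ge0 : 0 <= \sum_(i < r) (q i - p i).
  by apply: sumr_ge0 => i _; rewrite subr_ge0; have [] := pq i.
move: pqd; rewrite ltr_pdivlMr ?ltr_wpDl// mulrDr mulr1 mulrC; lra.
Qed.

End SmoothFunctions.

(** * Combinations of decaying exponentials *)

Section Modes.
Variables (R : realType) (K : nat).

(** The rates are negative, for decay, and pairwise distinct, so that their differences can be
    divided by. *)
Definition mode_rates : 'rV[R]_K := \row_k - (k.+1)%:R.

Definition modes (t : R) : 'cV[R]_K := \col_k expR (mode_rates ord0 k * t).

Lemma modes0 : modes 0 = const_mx 1.
Proof. by apply/matrixP => i j; rewrite !mxE mulr0 expR0. Qed.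

Lemma is_derive_modes a (M : 'M[R]_(a, K)) (t : R) :
  is_derive t 1 (fun r => M *m modes r) (M *m diag_mx mode_rates *m modes t).
Proof.
apply: is_derive_mx => i j.
have -> : (fun r => (M *m modes r) i j) =
    \sum_k (fun r => M i k * expR (mode_rates ord0 k * r)).
  apply/funext => r; rewrite fct_sumE mxE; apply: eq_bigr => k _.
  by rewrite [modes r k j]mxE.
rewrite -mulmxA mxE; apply: is_derive_sum => k.
rewrite mul_diag_mx mxE [modes t k j]mxE.
apply: is_derive_eq.
by rewrite /GRing.scale /= mulr1 [expR _ * _]mulrC.
Qed.

Lemma continuous_modes a (M : 'M[R]_(a, K)) i :
  continuous (fun t => (M *m modes t) i ord0).
Proof.
move=> t; apply/differentiable_continuous/derivable1_diffP.
by have [] := is_derive_mxE i ord0 (is_derive_modes M t).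
Qed.

(** The slowest rate is -1, so every exponential is at most [expR (- t)] for [t >= 0]. *)
Lemma modes_norm_le a (M : 'M[R]_(a, K)) : exists2 C : R, 0 <= C &
  forall t, 0 <= t -> `|M *m modes t| <= C * expR (- t).
Proof.
exists (\sum_i \sum_k `|M i k|) => [|t t_ge0].
  by do 2!apply: sumr_ge0 => ? _.
rewrite [leLHS]/Num.Def.normr/= mx_normrE; apply: bigmax_le => /= [|[i j] _ /=].
  by rewrite mulr_ge0 ?expR_ge0//; do 2!apply: sumr_ge0 => ? _.
rewrite (bigD1 i)//= mulrDl ler_wpDr//.
  by rewrite mulr_ge0 ?expR_ge0//; do 2!apply: sumr_ge0 => ? _.
rewrite mxE (le_trans (ler_norm_sum _ _ _))// mulr_suml; apply: ler_sum => k _.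
rewrite normrM ler_wpM2l// !mxE ger0_norm ?expR_ge0// ler_expR mulNr lerN2.
by rewrite ler_peMl// ler1n.
Qed.

End Modes.

(** The matrix equation says, column by column, that the columns of [X] and [U] are modes. All
    exponentials equal 1 at time 0, so the sum of the columns of [X] is the initial state. *)
Lemma completely_stabilizable_modes (R : realType) (l n m K : nat) (s : system R l n m) :
  (forall x0 : 'cV[R]_n, exists (X : 'M[R]_(n, K)) (U : 'M[R]_(m, K)),
     s.1.1 *m X *m diag_mx (mode_rates R K) = s.1.2 *m X + s.2 *m U /\
     X *m const_mx 1 = x0) ->
  completely_stabilizable s.
Proof.
case: s => [[E A] B] /= sX x0; have [X [U [EX X1]]] := sX x0.
exists (fun t => X *m modes K t), (fun t => U *m modes K t); split.
- have dEX (t : R) : is_derive t (1 : R) (fun r => E *m (X *m modes K r))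
      (A *m (X *m modes K t) + B *m (U *m modes K t)).
    rewrite !mulmxA -mulmxDl -EX.
    under eq_fun do rewrite mulmxA.
    exact: is_derive_modes.
  split.
  + by apply: L1loc_continuous => i; exact: continuous_modes.
  + by apply: L1loc_continuous => i; exact: continuous_modes.
  + apply: (locally_absolutely_continuous_C1 dEX) => i.
    under eq_fun do rewrite !mulmxA -mulmxDl.
    exact: continuous_modes.
  + exact: aeW.
- by rewrite modes0.
- have [C C_ge0 XC] := modes_norm_le X.
  apply: (squeeze_cvge (f := cst 0%E) (h := fun t => (C * expR (- t))%:E)).
  + near=> t; apply/andP; split; first exact: ess_sup_on_ge.
    have t_ge0 : 0 <= t by near: t; exact: nbhs_pinfty_ge.
    apply: ess_sup_on_le => r tr; apply: le_trans (XC r _) _.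
      by rewrite (le_trans t_ge0)// ltW.
    by rewrite ler_wpM2l// ler_expR lerN2 ltW.
  + exact: cvg_cst.
  + apply: cvg_EFin; first by near=> t.
    rewrite -[X in _ --> X](mulr0 C) /=; apply: cvgMr => //.
    exact: cvgr_expR.
Unshelve. all: by end_near. Qed.

(** * Genericity of the surjectivity condition *)

Section Entries.
Variables (R : realType) (l n m : nat).
Local Notation N := (l * n + l * n + l * m)%N.

Definition unentries (v : 'rV[R]_N) : system R l n m :=
  (vec_mx (lsubmx (lsubmx v)), vec_mx (rsubmx (lsubmx v)), vec_mx (rsubmx v)).

Lemma entriesK : cancel (@entries R l n m) unentries.
Proof.
by case=> [[E A] B]; rewrite /unentries /entries !(row_mxKl, row_mxKr) !mxvecK.
Qed.

Lemma unentriesK : cancel unentries (@entries R l n m).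
Proof. by move=> v; rewrite /entries /= !vec_mxK !hsubmxK. Qed.

Lemma polynomial_unentries :
  [/\ polynomial_mx (fun v => (unentries v).1.1),
      polynomial_mx (fun v => (unentries v).1.2) &
      polynomial_mx (fun v => (unentries v).2)].
Proof.
by split=> i j; apply: polynomial_fun_ext (polynomial_fun_coord _ _) => v;
  rewrite !mxE.
Qed.

Lemma entries_preimage (P : system R l n m -> Prop) v :
  [set entries s | s in [set s | P s]] v <-> P (unentries v).
Proof.
split=> [[s Ps <-]|Pv]; first by rewrite entriesK.
by exists (unentries v); rewrite ?unentriesK.
Qed.

End Entries.

Section ModeMatrix.
Variables (R : realType) (l n m : nat).
Local Notation D := (diag_mx (mode_rates R n)).

(** Matrix of the map from [(X, U)] to [(E X D - A X - B U, X 1)], acting on the flattened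
    [col_mx X U] as a row vector; surjectivity is therefore [row_full]. The zero blocks discard
    [U]. *)
Definition mode_mx (s : system R l n m) : 'M[R]_((n + m) * n, l * n + n * 1) :=
  row_mx (lin_mx (mulmxr D \o mulmx (row_mx s.1.1 0)) -
          lin_mx (mulmx (row_mx s.1.2 s.2)))
         (lin_mx (mulmxr (const_mx 1) \o mulmx (row_mx 1%:M 0))).

Lemma mxvec_mode_mx (s : system R l n m) (X : 'M[R]_n) (U : 'M[R]_(m, n)) :
  mxvec (col_mx X U) *m mode_mx s =
  row_mx (mxvec (s.1.1 *m X *m D - (s.1.2 *m X + s.2 *m U)))
         (mxvec (X *m const_mx 1 : 'cV_n)).
Proof.
rewrite mul_mx_row mulmxBr !mul_rV_lin /= mxvecK !mul_row_col.
by rewrite !mul0mx !addr0 mul1mx -linearB.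
Qed.

Lemma mode_mx_surjective (s : system R l n m) :
  row_full (mode_mx s) <->
  forall (C : 'M[R]_(l, n)) (x0 : 'cV[R]_n),
    exists (X : 'M[R]_n) (U : 'M[R]_(m, n)),
      s.1.1 *m X *m D - (s.1.2 *m X + s.2 *m U) = C /\ X *m const_mx 1 = x0.
Proof.
split=> [/row_fullP[T TM] C x0|sM].
  pose Z := vec_mx (row_mx (mxvec C) (mxvec x0) *m T) : 'M[R]_(n + m, n).
  have := mxvec_mode_mx s (usubmx Z) (dsubmx Z).
  rewrite vsubmxK vec_mxK -mulmxA TM mulmx1 => /eq_row_mx[ZC Zx0].
  exists (usubmx Z), (dsubmx Z); split; apply: (can_inj mxvecK); exact/esym.
rewrite -sub1mx; apply/row_subP => i; apply/submxP.
set c := row i _.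
have [X [U [XC Xx0]]] := sM (vec_mx (lsubmx c)) (vec_mx (rsubmx c)).
exists (mxvec (col_mx X U)).
by rewrite mxvec_mode_mx XC Xx0 !vec_mxK hsubmxK.
Qed.

(** The rows of [lin_mx] are the flattened images of the elementary matrices, which do not depend on
    [v]. *)
Lemma polynomial_lin_mx N a b c d
    (f : 'rV[R]_N -> {linear 'M[R]_(a, b) -> 'M[R]_(c, d)}) :
  (forall Y, polynomial_mx (fun v => f v Y)) ->
  polynomial_mx (fun v => lin_mx (f v)).
Proof.
move=> pf i j; case/mxvec_indexP: j => j k.
apply: polynomial_fun_ext (pf (vec_mx (delta_mx 0 i)) j k) => v.
by rewrite !mxE /= mxvecE.
Qed.

Lemma polynomial_mode_mx : polynomial_mx (fun v => mode_mx (unentries v)).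
Proof.
have [pE pA pB] := polynomial_unentries R l n m.
apply: polynomial_mx_row; last exact: polynomial_mx_cst.
apply: polynomial_mxB; apply: polynomial_lin_mx => Y /=.
  apply: polynomial_mxM; last exact: polynomial_mx_cst.
  apply: polynomial_mxM; last exact: polynomial_mx_cst.
  by apply: polynomial_mx_row => //; exact: polynomial_mx_cst.
apply: polynomial_mxM; last exact: polynomial_mx_cst.
exact: polynomial_mx_row.
Qed.

Lemma mode_mx_full_stabilizable (s : system R l n m) :
  row_full (mode_mx s) -> completely_stabilizable s.
Proof.
move=> /mode_mx_surjective sM; apply: (@completely_stabilizable_modes _ _ _ _ n) => x0.
have [X [U [/eqP + X1]]] := sM 0 x0; rewrite subr_eq0 => /eqP EX.
by exists X, U.
Qed.

(** An index out of range yields 0; this encodes the zero rows of a partial identity. *)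
Lemma sum_eq_nat k (a : nat) (F : 'I_k -> R) :
  \sum_(j < k) (j == a :> nat)%:R * F j = oapp F 0 (insub a).
Proof.
case: insubP => [i _ <-|ka] /=.
  rewrite (bigD1 i)//= eqxx mul1r big1 ?addr0// => j ji.
  by rewrite (negbTE (ji : j != i :> nat)) mul0r.
apply: big1 => j _; case: eqP => [ja|]; last by rewrite mul0r.
by move: ka; rewrite -ja ltn_ord.
Qed.

Lemma mode_mx_full_exists : (0 < n)%N -> (0 < m)%N -> (l < n + m)%N ->
  exists s : system R l n m, row_full (mode_mx s).
Proof.
move=> n_gt0 m_gt0 lnm.
(* In column k, E X D - E D X misses coordinate k; the first input covers it,
   acting on all rows i < n (where i - n.-1 truncates to 0), and the other inputs
   cover the rows i >= n one by one. *)
pose E : 'M[R]_(l, n) := \matrix_(i, j) (j == i :> nat)%:R.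
pose B : 'M[R]_(l, m) := \matrix_(i, j) (j == i - n.-1 :> nat)%N%:R.
exists (E, E *m D, B); apply/mode_mx_surjective => C x0 /=.
(* Extension of [C] by 0 to all row indices, as [n] may exceed [l]. *)
pose c i k := oapp (fun i' : 'I_l => C i' k) 0 (insub i).
(* Entry [(j, k)] of [X D - D X] is that of [X] times the difference of rates, hence
   [c j k - c k k]; for [j = k] both sides are 0. *)
pose X : 'M[R]_n := \matrix_(j, k) ((c j k - c k k) /
  (mode_rates R n ord0 k - mode_rates R n ord0 j)).
pose U : 'M[R]_(m, n) := \matrix_(j, k)
  - c (if j == 0 :> nat then k : nat else n.-1 + j)%N k.
(* A diagonal matrix commutes with [D], so adding [diag_mx d] corrects the initial state without
   disturbing the equation. *)
have [d dE] : exists d : 'rV[R]_n, d^T = x0 - X *m const_mx 1.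
  by exists (x0 - X *m const_mx 1)^T; rewrite trmxK.
have d1 : diag_mx d *m const_mx 1 = d^T :> 'cV[R]_n.
  by apply/colP => i; rewrite mul_diag_mx !mxE mulr1.
exists (X + diag_mx d), U; split; last by rewrite mulmxDl d1 dE addrC subrK.
have -> : E *m (X + diag_mx d) *m D - (E *m D *m (X + diag_mx d) + B *m U) =
    E *m (X *m D - D *m X) - B *m U.
  rewrite -!(mulmxA E) mulmxDl !mulmxDr mulmxN (diag_mxC d) opprD addrA.
  by congr (_ - _); rewrite opprD addrACA subrr addr0.
apply/matrixP => i k.
have EE (Y : 'M[R]_n) : (E *m Y) i k = oapp (Y ^~ k) 0 (insub (val i)).
  by rewrite -sum_eq_nat mxE; apply: eq_bigr => j _; rewrite mxE.
have BU : (B *m U) i k = oapp (U ^~ k) 0 (insub (i - n.-1)%N).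
  by rewrite -sum_eq_nat mxE; apply: eq_bigr => j _; rewrite mxE.
have ci : c i k = C i k by rewrite /c valK.
have BUE : (B *m U) i k = - c (if (i < n)%N then k : nat else i) k.
  (* The dimension count [l < n + m] enters here: there are enough inputs for the rows not reached
     by [E]. *)
  have im : (i - n.-1 < m)%N by have := ltn_ord i; lia.
  rewrite BU insubT.
  rewrite /= mxE /=; congr (- c _ _); case: ifP; case: ifP => //; lia.
rewrite [LHS]mxE [X in _ + X]mxE EE BUE opprK.
case: insubP => [j jn ji|]; last by move=> /negbTE ->; rewrite add0r.
rewrite jn /= mul_mx_diag mul_diag_mx !mxE.
have [jk|jk] := eqVneq j k.
  by rewrite -ci -ji jk !(subrr, mul0r, mulr0, add0r).
have rates_neq : (- k.+1%:R) - (- j.+1%:R) != 0 :> R.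
  by rewrite subr_eq0 eqr_opp eqr_nat eqSS eq_sym.
by rewrite [- j.+1%:R * _]mulrC -mulrBr divfK// subrK ji ci.
Qed.

End ModeMatrix.

(** * Systems that expand the norm of the state *)

Section Unstable.
Variable R : realType.

Lemma locally_absolutely_continuous_continuous k (f : R -> 'cV[R]_k) :
  locally_absolutely_continuous f -> continuous f.
Proof.
move=> fac t; apply/cvgrPdist_lt => /= e e_gt0.
have [d d_gt0 fd] := fac (t - 1) (t + 1) e e_gt0.
have fpq p q : t - 1 <= p -> p <= q -> q <= t + 1 -> q - p < d -> `|f q - f p| < e.
  move=> tp pq qt qpd; have := fd 1%N (fun=> p) (fun=> q).
  rewrite !big_ord1; apply=> // i j _ _ _; by rewrite !ord1.
near=> s.
have : `|t - s| < Num.min 1 d.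
  by near: s; apply: cvgr_dist_lt; rewrite ?lt_min ?ltr01.
rewrite lt_min => /andP[].
have [ts|st] := leP t s.
  rewrite ler0_norm ?subr_le0// opprB => s1 sd.
  by rewrite distrC; apply: fpq => //; lra.
by rewrite gtr0_norm ?subr_gt0// => s1 sd; apply: fpq => //; lra.
Unshelve. all: by end_near. Qed.

Lemma mulmx_coord_norm_le a b (P : 'M[R]_(a, b)) (w : 'cV[R]_b) i :
  `|(P *m w) i ord0| <= (\sum_j `|P i j|) * `|w|.
Proof.
rewrite mxE (le_trans (ler_norm_sum _ _ _))// mulr_suml; apply: ler_sum => j _.
rewrite normrM ler_wpM2l// [leRHS]/Num.Def.normr/= mx_normrE.
exact: (le_bigmax _ (fun ij => `|w ij.1 ij.2|) (j, ord0)).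
Qed.

(** On a compact interval [y] is bounded, and there a quadratic function of [y] is Lipschitz in
    [y]. *)
Lemma abs_cont_on_sqr_norm a b (P : 'M[R]_(a, b)) (y : R -> 'cV[R]_b) (t0 t1 : R) :
  locally_absolutely_continuous y ->
  abs_cont_on t0 t1 (fun t => \sum_i ((P *m y t) i ord0) ^+ 2).
Proof.
move=> yac e e_gt0.
have yc := locally_absolutely_continuous_continuous yac.
have := continuous_compact (continuous_subspaceT yc) (@segment_compact R t0 t1).
move=> /compact_bounded[M0 [_ mrt]].
pose M := `|M0| + 1.
have yM t : t0 <= t <= t1 -> `|y t| <= M.
  move=> tb; apply: (mrt M); first by rewrite (le_lt_trans (ler_norm M0))// ltrDl.
  by exists t => //=; rewrite in_itv.
pose s i := \sum_j `|P i j|.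
have s_ge0 i : 0 <= s i by apply: sumr_ge0.
have M_ge0 : 0 <= M by rewrite addr_ge0.
(* From [u^2 - v^2 = (u - v) (u + v)]: coordinate [i] of the difference contributes a factor [s i],
   that of the sum at most [2 * s i * M]. *)
pose L := \sum_i s i * (2 * s i * M).
have L_ge0 : 0 <= L by apply: sumr_ge0 => i _; rewrite !mulr_ge0.
have [d d_gt0 yd] := yac t0 t1 (e / (L + 1)) (divr_gt0 e_gt0 (ltr_wpDl L_ge0 ltr01)).
exists d => // r p q pq tpq pqd; have := yd r p q pq tpq pqd.
rewrite ltr_pdivlMr ?ltr_wpDl// => ye.
apply: (@le_lt_trans _ _ (L * \sum_(i < r) `|y (q i) - y (p i)|)); last first.
  have : 0 <= \sum_(i < r) `|y (q i) - y (p i)| by apply: sumr_ge0.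
  by move: ye; rewrite mulrDr mulr1 mulrC; lra.
rewrite mulr_sumr; apply: ler_sum => k _; have [pk pqk qk] := pq k.
rewrite -sumrB mulr_suml (le_trans (ler_norm_sum _ _ _))//; apply: ler_sum => i _.
rewrite subr_sqr normrM mulrAC; apply: ler_pM => //.
  have := mulmx_coord_norm_le P (y (q k) - y (p k)) i.
  by rewrite mulmxBr !mxE.
rewrite (le_trans (ler_normD _ _))// -mulrA mulr2n mulrDl mul1r.
apply: lerD; apply: le_trans (mulmx_coord_norm_le _ _ _) _; apply: ler_wpM2l;
  rewrite ?s_ge0//; by apply: yM; lra.
Qed.

(** [P E = c] recovers [c x] from the absolutely continuous [E x], and [P B = 0] removes the input.
    The squared Euclidean norm of [c x] thus has derivative [2 c x^T P A x >= 0] almost everywhere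
    and cannot decrease. *)
Lemma not_completely_stabilizable l n m (E A : 'M[R]_(l, n)) (B : 'M[R]_(l, m))
    (P : 'M[R]_(n, l)) (c : R) : (0 < n)%N -> 0 < c ->
  P *m E = c%:M -> P *m B = 0 ->
  (forall x : 'cV[R]_n, 0 <= \sum_i x i ord0 * (P *m A *m x) i ord0) ->
  ~ completely_stabilizable (E, A, B).
Proof.
move=> n_gt0 c_gt0 PE PB PA /(_ (const_mx 1)) [x [u [[_ _ Exac dEx] x0 x_lim]]].
have PEx t : P *m (E *m x t) = c *: x t by rewrite mulmxA PE mul_scalar_mx.
pose g t := \sum_i ((P *m (E *m x t)) i ord0) ^+ 2.
have gE t : g t = c ^+ 2 * \sum_i (x t i ord0) ^+ 2.
  by rewrite mulr_sumr; apply: eq_bigr => i _; rewrite PEx mxE exprMn.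
have g_mono t : 0 <= t -> g 0 <= g t.
  move=> t_ge0; apply: (abs_cont_nondecreasing t_ge0 _ dEx).
    exact: abs_cont_on_sqr_norm.
  move=> {t_ge0}t /contrapT dt.
  exists (\sum_i 2 * (c * x t i ord0) * (P *m A *m x t) i ord0).
    have dPEx : is_derive t 1 (fun r => P *m (E *m x r)) (P *m A *m x t).
      have PAx : P *m A *m x t = P *m (A *m x t + B *m u t).
        by rewrite mulmxDr !mulmxA PB mul0mx addr0.
      rewrite PAx; apply: is_derive_mx => i j.
      rewrite (_ : (fun r => _) = \sum_k (fun r => P i k * (E *m x r) k j)); last first.
        by apply/funext => r; rewrite fct_sumE mxE.
      rewrite mxE; apply: is_derive_sum => k.
      by have dExkj := is_derive_mxE k j dt; apply: is_derive_eq.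
    rewrite (_ : g = \sum_i (fun r => (P *m (E *m x r)) i ord0) ^+ 2); last first.
      apply/funext => r; rewrite fct_sumE; apply: eq_bigr => i _.
      done.
    apply: is_derive_sum => i; have dPExi := is_derive_mxE i ord0 dPEx.
    apply: is_derive_eq.
    rewrite /GRing.scale /= PEx mxE expr1 mulr_natl //.
  under eq_bigr do rewrite -[2 * _ * _]mulrA -[_ * _ * _]mulrA.
  by rewrite -!mulr_sumr !mulr_ge0 ?(ltW c_gt0).
(* From the all-ones state the squared Euclidean norm starts at [n]; a maximum norm below 1 would
   make it smaller. *)
have x_ge1 t : 0 <= t -> 1 <= `|x t|.
  move=> /g_mono; rewrite !gE ler_pM2l ?exprn_gt0// x0 => xt.
  rewrite leNgt; apply/negP => xt1; move: xt; apply/negP; rewrite -ltNge.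
  apply: ltr_sum => [|i _].
    by apply/hasP; exists (Ordinal n_gt0); rewrite ?mem_index_enum.
  rewrite mxE expr1n -real_normK ?num_real// expr_lt1//; apply: le_lt_trans xt1.
  rewrite [leRHS]/Num.Def.normr/= mx_normrE.
  exact: (le_bigmax _ (fun ij => `|x t ij.1 ij.2|) (i, ord0)).
have : (1%:E <= (0 : \bar R))%E.
  apply: (cvge_to_ge x_lim).
  near=> t; apply: ess_sup_on_ge => r tr; apply: x_ge1.
  by apply: le_trans (ltW tr); near: t; exact: nbhs_pinfty_ge.
by rewrite lee_fin ler10.
Unshelve. all: by end_near. Qed.

(** The form is the sum of squares plus the form of [Q - 1]. Since [|x_i x_j|] is at most
    [(x_i^2 + x_j^2) / 2], entries bounded by [1 / n] cost at most the sum of squares. *)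
Lemma quadratic_form_ge0 n (Q : 'M[R]_n) :
  (forall i j, `|Q i j - (i == j)%:R| <= n%:R^-1) ->
  forall x : 'cV[R]_n, 0 <= \sum_i x i ord0 * (Q *m x) i ord0.
Proof.
case: n Q => [|n] Q Q1 x; first by rewrite big_ord0.
pose X := \sum_i (x i ord0) ^+ 2.
have QE : \sum_i x i ord0 * (Q *m x) i ord0 =
    X + \sum_i \sum_j x i ord0 * x j ord0 * (Q i j - (i == j)%:R).
  rewrite -big_split; apply: eq_bigr => i _ /=.
  under [X in _ = _ + X]eq_bigr do rewrite mulrBr.
  rewrite sumrB [X in _ - X](bigD1 i)//= eqxx mulr1 [X in _ - (_ + X)]big1 => [|j ji].
    rewrite addr0 -expr2 addrC subrK mxE mulr_sumr; apply: eq_bigr => j _.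
    by rewrite mulrCA mulrC.
  by rewrite eq_sym (negbTE ji) mulr0.
have bound i j : - (((x i ord0) ^+ 2 + (x j ord0) ^+ 2) / 2 * n.+1%:R^-1) <=
    x i ord0 * x j ord0 * (Q i j - (i == j)%:R).
  rewrite lerNl (le_trans (ler_norm _))// normrN normrM ler_pM//.
  have := sqr_ge0 (x i ord0 - x j ord0); have := sqr_ge0 (x i ord0 + x j ord0).
  by rewrite ler_norml => H1 H2; apply/andP; split; nra.
rewrite QE -lerBlDl sub0r.
have -> : X = \sum_i \sum_j ((x i ord0) ^+ 2 + (x j ord0) ^+ 2) / 2 * n.+1%:R^-1.
  have inner i : \sum_j ((x i ord0) ^+ 2 + (x j ord0) ^+ 2) / 2 * n.+1%:R^-1 =
      ((x i ord0) ^+ 2 *+ n.+1 + X) / 2 * n.+1%:R^-1.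
    by rewrite -!mulr_suml big_split /= sumr_const card_ord.
  rewrite (eq_bigr _ (fun i _ => inner i)) -!mulr_suml big_split /= sumr_const.
  rewrite card_ord sumrMnl -/X -mulr2n -[_ *+ 2]mulr_natr mulfK ?pnatr_eq0//.
  by rewrite -[X *+ _]mulr_natr mulfK ?pnatr_eq0.
rewrite -sumrN; apply: ler_sum => i _; rewrite -sumrN; exact: ler_sum.
Qed.

Lemma poly_eq0_near (q : {poly R}) : (\forall t \near 0, q.[t] = 0) -> q = 0.
Proof.
(* The points [e / 2], [e / 3], ... lie in the ball; taking [size q] of them gives too many roots
   for a nonzero [q]. *)
move=> /nbhs_ballP[e /= e_gt0 qe]; apply/eqP/negPn/negP => q_neq0.
pose rs := [seq e / k.+2%:R | k <- iota 0 (size q)].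
have : (size rs < size q)%N.
  apply: (max_poly_roots q_neq0).
    apply/allP => _ /mapP[k _ ->]; apply/rootP/qe.
    rewrite -ball_normE /= sub0r normrN gtr0_norm ?divr_gt0//.
    by rewrite ltr_pdivrMr// ltr_pMr// ltr1n.
  rewrite map_inj_uniq ?iota_uniq// => j k /(mulfI (lt0r_neq0 e_gt0)) /invr_inj /eqP.
  by rewrite eqr_nat => /eqP[].
by rewrite size_map size_iota ltnn.
Qed.
End Unstable.

(** * Left inverses of [E] that annihilate [B], and nearby systems *)

Section LeftInverse.
Variables (R : realType) (l n m : nat).

(** For [n + m <= l], the square block formed by the first [n + m] rows of [[E B]]. *)
Definition pencil_top (s : system R l n m) : 'M[R]_(n + m) :=
  pid_mx (n + m) *m row_mx s.1.1 s.2.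

(** The adjugate replaces the inverse so that the entries remain polynomial; the determinant becomes
    the scalar [c] in [P E = c]. *)
Definition state_projection (s : system R l n m) : 'M[R]_(n, l) :=
  row_mx 1%:M 0 *m \adj (pencil_top s) *m pid_mx (n + m).

Lemma state_projectionE s :
  state_projection s *m s.1.1 = (\det (pencil_top s))%:M /\
  state_projection s *m s.2 = 0.
Proof.
have : state_projection s *m row_mx s.1.1 s.2 =
    \det (pencil_top s) *: row_mx 1%:M 0.
  by rewrite /state_projection -!mulmxA mul_adj_mx mul_mx_scalar.
rewrite mul_mx_row scale_row_mx scaler0 scalemx1 => /eq_row_mx[-> ->].
by split.
Qed.

Lemma polynomial_pencil_top : polynomial_mx (fun v => pencil_top (unentries v)).
Proof.
have [pE _ pB] := polynomial_unentries R l n m.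
apply: polynomial_mxM; first exact: polynomial_mx_cst.
exact: polynomial_mx_row.
Qed.

Lemma polynomial_state_projection :
  polynomial_mx (fun v => state_projection (unentries v)).
Proof.
apply: polynomial_mxM; last exact: polynomial_mx_cst.
apply: polynomial_mxM; first exact: polynomial_mx_cst.
exact/polynomial_mx_adj/polynomial_pencil_top.
Qed.

Lemma not_generic_stabilizable : (0 < n)%N -> (n + m <= l)%N ->
  ~ generic [set entries s |
      s in [set s : system R l n m | completely_stabilizable s]].
Proof.
move=> n_gt0 nml /generic_polynomialP[f [v1 [pf fv1 fS]]].
(* The base system [E = A = [1; 0; 0]], [B = [0; 1; 0]], for which [P A] is the identity. *)
pose EB : 'M[R]_(l, n + m) := pid_mx (n + m).
pose v0 := entries (lsubmx EB, lsubmx EB, rsubmx EB).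
have G0 : pencil_top (unentries v0) = 1%:M.
  by rewrite entriesK /pencil_top /= hsubmxK mul_pid_mx minnn (minn_idPr nml) pid_mx_1.
have Q0 : state_projection (unentries v0) *m (unentries v0).1.2 = 1%:M.
  have := (state_projectionE (unentries v0)).1.
  by rewrite G0 det1 entriesK.
pose w := v1 - v0.
have [q qE] := polynomial_fun_line v0 w pf.
have [qd qdE] := polynomial_fun_line v0 w (polynomial_fun_det polynomial_pencil_top).
have [_ pA _] := polynomial_unentries R l n m.
have pQ := polynomial_mxM polynomial_state_projection pA.
(* Along the line the entries of [P A] are polynomials in [t], hence continuous at 0. *)
have /choice[qQ qQE] : forall ij : 'I_n * 'I_n, exists q : {poly R}, forall t,
    q.[t] = (state_projection (unentries (v0 + t *: w)) *m
             (unentries (v0 + t *: w)).1.2) ij.1 ij.2.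
  by move=> ij; exact: polynomial_fun_line (pQ ij.1 ij.2).
have hornerc (p : {poly R}) : {for 0, continuous (fun t => p.[t])}.
  exact: continuous_horner.
(* At [t = 1] the line reaches [v1], where [f] is nonzero. *)
suff q0 : q = 0.
  have := qE 1; rewrite q0 horner0 scale1r /w subrKC => /esym/eqP.
  exact/negP.
apply: poly_eq0_near; near=> t.
rewrite qE; apply: fS => /entries_preimage.
set s := unentries _ => s_stab.
have [PE PB] := state_projectionE s.
apply: (@not_completely_stabilizable _ _ _ _ s.1.1 s.1.2 s.2 (state_projection s)
  (\det (pencil_top s)) n_gt0 _ PE PB) => //; last first.
- apply: quadratic_form_ge0 => i j.
  have /= <- := qQE (i, j) t.
  have qQ0 : (qQ (i, j)).[0] = (i == j)%:R.
    by rewrite qQE scale0r addr0 Q0 mxE.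
  rewrite -qQ0 distrC; move: i j {qQ0}.
  suff H : forall ij : 'I_n * 'I_n, `|(qQ ij).[0] - (qQ ij).[t]| <= n%:R^-1.
    by move=> i j; exact: H.
  (* There are finitely many entries, so one neighbourhood serves them all. *)
  near: t; apply: filter_forall => ij.
  apply: cvgr_dist_le; first exact: hornerc.
  by rewrite invr_gt0 ltr0n.
- rewrite -qdE; near: t.
  apply: (cvgr_gt (qd.[0])); first exact: hornerc.
  by rewrite qdE scale0r addr0 G0 det1.
Unshelve. all: by end_near. Qed.

End LeftInverse.

Theorem proposition6p4 (R : realType) (l n m : nat)
    (l_gt0 : (0 < l)%N) (n_gt0 : (0 < n)%N) (m_gt0 : (0 < m)%N) :
  generic [set entries s |
            s in [set s : system R l n m | completely_stabilizable s]]
  <-> (l < n + m)%N.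
Proof.
split=> [gen|lnm].
  by rewrite ltnNge; apply/negP => nml; exact: not_generic_stabilizable gen.
have [s0 s0_full] := mode_mx_full_exists R n_gt0 m_gt0 lnm.
have s0_full' : row_full (mode_mx (unentries (entries s0))) by rewrite entriesK.
have [V [Vvar Vproper SV]] := generic_row_full (@polynomial_mode_mx R l n m) s0_full'.
(* Full rank implies stabilizability, so the same variety also contains the complement of the larger
   set. *)
exists V; split=> // v nSv; apply: SV => /mode_mx_full_stabilizable vS.
exact/nSv/entries_preimage.
Qed.
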